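(* Suppose $H=(V,E)$ is a hypergraph on $n=|V|$ vertices with maximum density $\mu(H)\le\alpha$ for some constant $\alpha$. Then $V$ can be partitioned into $\ell=\lceil\log n\rceil$ layers, $V=L_1\cup L_2\cup\cdots\cup L_\ell$, such that each vertex $v\in L_i$ has degree at most $2\alpha$ in $H_i=H[L_i\cup L_{i+1}\cup\cdots\cup L_\ell]$.
   Context: A hypergraph $H=(V,E)$ has a finite vertex set $V$ and a set $E$ of nonempty subsets of $V$; the degree of a vertex is the number of edges containing it. For nonempty $U\subseteq V$ the restriction is $H[U]=(U,E[U])$ with $E[U]=\{e\cap U: e\in E,\ |e\cap U|\ge 2\}$; the density of $U$ is $\mu_H(U)=\frac1{|U|}\sum_{e\in E[U]}|e|$; the maximum density is $\mu(H)=\max_{\emptyset\ne U\subseteq V}\mu_H(U)$. Logarithms are base $2$; layers may be empty.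
   Formalization: The formal statement assumes n ≥ 2: for n = 1 the formula gives ⌈log 1⌉ = 0 layers, which cannot cover the single vertex, and for n = 0 both log n and the maximum density are undefined. *)

(* Defs.v *)
From mathcomp Require Import all_boot all_order all_algebra.
From mathcomp Require Import reals exp.

Set Implicit Arguments.
Unset Strict Implicit.
Unset Printing Implicit Defensive.

Import Order.TTheory GRing.Theory Num.Theory.

Local Open Scope ring_scope.

(* The vertex set is an arbitrary subset of an ambient finite type, so that a
   hypergraph and its restrictions have the same type. *)
Record hypergraph (T : finType) := Hypergraph {
  vertices : {set T};
  edges : {set {set T}};
  edges_sub : forall e, e \in edges -> e \subset vertices;
  edges_neq0 : forall e, e \in edges -> e != set0
}.

Definition degree (T : finType) (H : hypergraph T) (v : T) : nat :=
  #|[set e in edges H | v \in e]|.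

(* Edges form a set: distinct edges with the same trace on U are merged. *)
Definition restr_edges (T : finType) (H : hypergraph T) (U : {set T}) :
    {set {set T}} :=
  [set e :&: U | e in edges H & (2 <= #|e :&: U|)%N].

Lemma restr_edges_sub (T : finType) (H : hypergraph T) (U : {set T}) e :
  e \in restr_edges H U -> e \subset U.
Proof. by case/imsetP=> f _ ->; exact: subsetIr. Qed.

Lemma restr_edges_neq0 (T : finType) (H : hypergraph T) (U : {set T}) e :
  e \in restr_edges H U -> e != set0.
Proof.
case/imsetP=> f; rewrite inE => /andP[_ f2] ->.
by rewrite -card_gt0 (leq_trans _ f2).
Qed.

Definition restrict (T : finType) (H : hypergraph T) (U : {set T}) :
    hypergraph T :=
  Hypergraph (@restr_edges_sub T H U) (@restr_edges_neq0 T H U).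

Definition density (R : realType) (T : finType) (H : hypergraph T)
    (U : {set T}) : R :=
  (\sum_(e in edges (restrict H U)) #|e|)%:R / #|U|%:R.

(* Densities are nonnegative, so the default value 0 of the iterated maximum
   only matters when H has no vertex. *)
Definition max_density (R : realType) (T : finType) (H : hypergraph T) : R :=
  \big[Num.max/0]_(U : {set T} | (U != set0) && (U \subset vertices H))
    density R H U.

Definition log2 (R : realType) (x : R) : R := ln x / ln 2.

(* [absz] only casts to [nat]: the ceiling is nonnegative since [ln n >= 0]
   for every natural number n. *)
Definition num_layers (R : realType) (n : nat) : nat :=
  `|Num.ceil (log2 (n%:R : R))|%N.

(* Main.v *)
Require Import Defs.
From mathcomp Require Import all_boot all_order all_algebra.
From mathcomp Require Import reals exp.

Set Implicit Arguments.
Unset Strict Implicit.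
Unset Printing Implicit Defensive.

Import Order.TTheory GRing.Theory Num.Theory.

Local Open Scope ring_scope.

(** Peel off repeatedly the vertices of degree at most [2 * alpha] in what is
    left. The average degree in any restriction is at most [alpha], so by Markov's
    inequality strictly fewer than half of the vertices survive each round. As
    [n <= 2 ^ ceil (log2 n)], fewer than one vertex survives all the rounds. *)

(** Double counting of incident pairs; edges lie inside the vertex set, so every element of an edge
    is counted. *)
Lemma sum_degree (T : finType) (H : hypergraph T) :
  (\sum_(v in vertices H) degree H v = \sum_(e in edges H) #|e|)%N.
Proof.
under eq_bigr => v _.
  rewrite /degree -sum1_card (eq_bigl (fun e => (e \in edges H) && (v \in e)));
    last by move=> e; rewrite inE.
  over.
rewrite (exchange_big_dep (mem (edges H))) /=; last by move=> v e _ /andP[].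
apply: eq_bigr => e eH; rewrite -sum1_card; apply: eq_bigl => v.
rewrite eH /=; apply: andb_idl; exact: (subsetP (edges_sub eH)).
Qed.

Lemma density_le_max (R : realType) (T : finType) (H : hypergraph T)
    (U : {set T}) :
  U != set0 -> U \subset vertices H -> density R H U <= max_density R H.
Proof. by move=> U0 UV; apply: le_bigmax_cond; rewrite U0. Qed.

Lemma max_density_ge0 (R : realType) (T : finType) (H : hypergraph T) :
  0 <= max_density R H.
Proof. exact: bigmax_ge_id. Qed.

(** One round of peeling: these are the survivors. *)
Definition dense_part (R : realType) (T : finType) (H : hypergraph T)
    (d : R) (U : {set T}) : {set T} :=
  [set v in U | d < (degree (restrict H U) v)%:R].

Lemma card_dense_part (R : realType) (T : finType) (H : hypergraph T)
    (alpha : R) (U : {set T}) :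
  max_density R H <= alpha -> U != set0 -> U \subset vertices H ->
  (2 * #|dense_part H (2 * alpha) U| < #|U|)%N.
Proof.
move=> Ha U0 UV; set W := dense_part _ _ _.
have Ugt0 : (0 < #|U|)%N by rewrite card_gt0.
have [->|/set0Pn[w wW]] := eqVneq W set0; first by rewrite cards0.
have WU : W \subset U by apply/subsetP => v; rewrite inE => /andP[].
have a0 : 0 <= alpha := le_trans (max_density_ge0 R H) Ha.
have: density R H U <= alpha := le_trans (density_le_max R U0 UV) Ha.
rewrite /density ler_pdivrMr ?ltr0n // -sum_degree natr_sum /= => sumU.
(* Markov's inequality: drop the degrees outside [W]. The inequality is strict because [W] contains
   [w]. *)
have sumW : \sum_(v in W) (2 * alpha) < alpha * #|U|%:R.
  apply: lt_le_trans sumU; rewrite (big_setID (A := U) W) /= (setIidPr WU).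
  rewrite -[ltLHS]addr0 ltr_leD ?sumr_ge0 //.
  apply: ltr_sum; last by move=> v; rewrite inE => /andP[].
  by apply/hasP; exists w; rewrite ?mem_index_enum.
move: sumW; rewrite sumr_const -[_ *+ #|W|]mulr_natr (mulrC 2) -mulrA -natrM => sumW.
(* Multiplying the negated goal by [alpha >= 0], rather than dividing by [alpha], also covers
   [alpha = 0]. *)
rewrite -(ltr_nat R) ltNge; apply/negP => UW.
by have := lt_le_trans sumW (ler_wpM2l a0 UW); rewrite ltxx.
Qed.

Lemma leq_exp_num_layers (R : realType) (n : nat) :
  (0 < n)%N -> (n <= 2 ^ num_layers R n)%N.
Proof.
move=> n0; have ln2 : 0 < ln 2 :> R by rewrite ln_gt0 ?ltr1n.
rewrite -(ler_nat R) natrX -ler_ln ?posrE ?ltr0n ?exprn_gt0 //.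
rewrite lnXn ?ltr0n // -[leRHS]mulr_natl -ler_pdivrMr //.
apply: le_trans (ceil_ge _) _.
by rewrite /num_layers [leRHS]pmulrn ler_int lez_abs.
Qed.

Lemma antimono_chain (T : finType) (U : nat -> {set T}) :
  (forall k, U k.+1 \subset U k) -> forall j k, (j <= k)%N -> U k \subset U j.
Proof.
apply: (homo_leq (r := fun A B : {set T} => B \subset A)) => // B A C AB BC.
exact: subset_trans BC AB.
Qed.

(** Each element of [U i] lies in the difference just before the first set of the chain that misses
    it. With [i = 0] this shows that the layers cover; for general [i] it identifies the vertex set
    of [H_i]. *)
Lemma bigcup_chain_diff (T : finType) (U : nat -> {set T}) (l i : nat) :
  (forall k, U k.+1 \subset U k) -> U l = set0 ->
  \bigcup_(j < l | (i <= j)%N) (U j :\: U j.+1) = U i.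
Proof.
move=> Udec Ul; have Umono := antimono_chain Udec.
apply/setP => v; apply/bigcupP/idP => [[j ij]|vU].
  by rewrite inE => /andP[_]; apply: (subsetP (Umono _ _ ij)).
have ex : exists k, v \notin U k by exists l; rewrite Ul inE.
case: (ex_minnP ex) => -[|k] vk kmin.
  by case/negP: vk; apply: (subsetP (Umono _ _ (leq0n i))).
have kl : (k < l)%N by apply: kmin; rewrite Ul inE.
exists (Ordinal kl) => /=.
  rewrite leqNgt; apply: contra vk => ki; exact: (subsetP (Umono _ _ ki)).
by rewrite inE vk; apply: contraT => /kmin; rewrite ltnn.
Qed.

Theorem proposition44 (R : realType) (T : finType) (H : hypergraph T)
    (alpha : R) :
  (1 < #|vertices H|)%N ->
  max_density R H <= alpha ->
  exists L : 'I_(num_layers R #|vertices H|) -> {set T},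
    [/\ \bigcup_i L i = vertices H,
        forall i j, i != j -> [disjoint L i & L j]
      & forall i v, v \in L i ->
          (degree (restrict H (\bigcup_(j < num_layers R #|vertices H| | (i <= j)%N) L j)) v)%:R
            <= 2 * alpha].
Proof.
move=> n1 Ha; set n := #|vertices H| in n1 *; set l := num_layers R n.
pose U k := iter k (dense_part H (2 * alpha)) (vertices H).
have Udec k : U k.+1 \subset U k.
  by apply/subsetP => v; rewrite inE => /andP[].
have UV k : U k \subset vertices H.
  by elim: k => // k; apply: subset_trans.
(* The index starts at 1 because round 0 gives only equality. The first round makes the bound
   strict; later rounds need only weak halving. *)
have Ucard k : (2 ^ k.+1 * #|U k.+1| < n)%N.
  elim: k => [|k IH]; first by rewrite card_dense_part // -card_gt0 ltnW.
  have [Uk0|Uk0] := eqVneq (U k.+1) set0.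
    have := Udec k.+1; rewrite Uk0 subset0 => /eqP ->.
    by rewrite cards0 muln0 ltnW.
  apply: leq_ltn_trans IH; rewrite expnSr -mulnA leq_mul //.
  exact/ltnW/(card_dense_part Ha Uk0 (UV _)).
have nl : (n <= 2 ^ l)%N by rewrite leq_exp_num_layers // ltnW.
have Ul : U l = set0.
  (* Zero layers would force [n <= 1]. *)
  case: l nl => [|k] nl; first by rewrite leqNgt n1 in nl.
  apply/eqP; rewrite -cards_eq0 -leqn0 -ltnS -(ltn_pmul2l (expn_gt0 2 k.+1)).
  by rewrite muln1 (leq_trans (Ucard k)).
(* Layer [i] consists of the vertices peeled off in round [i]. *)
exists (fun i : 'I_l => U i :\: U i.+1); split.
- exact: (bigcup_chain_diff (U := U) 0 Udec Ul).
- have Umono := antimono_chain Udec.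
  suff dis (i j : 'I_l) : (i < j)%N -> [disjoint U i :\: U i.+1 & U j :\: U j.+1].
    by move=> i j; rewrite neq_ltn => /orP[/dis //|/dis]; rewrite disjoint_sym.
  move=> ij; rewrite disjoints_subset; apply/subsetP => v; rewrite in_setC !in_setD.
  case/andP=> vi _; rewrite negb_and; apply/orP; right.
  by apply: contra vi; apply: (subsetP (Umono _ _ ij)).
(* The layers from [i] on make up [U i], and [v] failed the survival test in exactly that
   restriction. *)
- move=> i v; rewrite (bigcup_chain_diff i Udec Ul) inE => /andP[+ vU].
  by rewrite inE vU /= -leNgt.
Qed.
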